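(* Let $s$ be the unique solution to the linear system $Cx=d$, where $C\in\mathbb{C}^{N\times N}$ and $d\in\mathbb{C}^N$, which we express in the form $(I-T)x=d$, i.e. $x=Tx+d$, with $T=I-C$, and let the vector sequence $\{x_m\}$ be produced by the fixed-point iterative scheme $$x_{m+1}=Tx_m+d,\qquad m=0,1,\ldots.$$ Define the residual vector of $x$ via $r(x)=d-Cx$. Let $s_k\equiv s_{0,k}$ be the approximation to $s$ produced by SVD-MPE (assumed to exist), and let $g_0,\ldots,g_k$ be the left singular vectors of $\widetilde U_k$ (with $n=0$). Then the following are true: (1) $s_k$ is of the form $$s_k=x_0+\sum_{i=0}^{k-1}\delta_i(C^ir_0)\quad\text{for some scalars }\delta_i;\qquad r_0=r(x_0)=d-Cx_0.$$ (2) The residual vector $r(s_k)$ is orthogonal to $\mathrm{span}\{M^{1/2}g_0,M^{1/2}g_1,\ldots,M^{1/2}g_{k-1}\}$; thus $$(M^{1/2}g_i)^*r(s_k)=0,\qquad i=0,1,\ldots,k-1.$$ Consequently (when $u_0,\ldots,u_{k-1}$ are linearly independent, so that the subspaces involved are $k$-dimensional), SVD-MPE is a Krylov subspace method for the linear system $Cx=d$, with the Krylov subspace $\mathcal{K}_k(C;r_0)=\mathrm{span}\{r_0,Cr_0,\ldots,C^{k-1}r_0\}$ as its right subspace and $\mathrm{span}\{M^{1/2}g_0,M^{1/2}g_1,\ldots,M^{1/2}g_{k-1}\}$ as its left subspace.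
   Context: SVD-MPE (with $n=0$): for a vector sequence $\{x_m\}_{m\ge0}$ in $\mathbb{C}^N$ put $u_m=x_{m+1}-x_m$, and for an integer $k\ge1$ with $k+1\le N$ let $U_k=[\,u_0\,|\,u_1\,|\,\cdots\,|\,u_k\,]\in\mathbb{C}^{N\times(k+1)}$. Let $M\in\mathbb{C}^{N\times N}$ and $L_k\in\mathbb{C}^{(k+1)\times(k+1)}$ be hermitian positive definite, with hermitian positive definite square roots $M^{1/2}$, $L_k^{1/2}$, and $L_k^{-1/2}=(L_k^{1/2})^{-1}$. Let $\widetilde U_k=M^{1/2}U_kL_k^{-1/2}=G\Sigma H^*$ be a singular value decomposition: $G=[\,g_0\,|\,\cdots\,|\,g_k\,]\in\mathbb{C}^{N\times(k+1)}$ with $g_i^*g_j=\delta_{ij}$, $H=[\,h_0\,|\,\cdots\,|\,h_k\,]\in\mathbb{C}^{(k+1)\times(k+1)}$ with $h_i^*h_j=\delta_{ij}$, $\Sigma=\mathrm{diag}(\sigma_0,\ldots,\sigma_k)$ with $\sigma_0\ge\cdots\ge\sigma_k\ge0$. The vector $c=[c_0,\ldots,c_k]^T=L_k^{-1/2}h_k$ is the optimal solution of $\min_c\sqrt{(U_kc)^*M(U_kc)}$ subject to $c^*L_kc=1$ used by the method. The SVD-MPE approximation is $s_{0,k}=\sum_{i=0}^k\gamma_ix_i$ with $\gamma_i=c_i/\sum_{j=0}^kc_j$; it exists if and only if $\sum_{j=0}^kc_j\ne0$. Projection method: let $\mathcal{Y}$ and $\mathcal{Z}$ be $k$-dimensional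 subspaces of $\mathbb{C}^N$ and $x_0\in\mathbb{C}^N$ given. A projection method for $Cx=d$ with right subspace $\mathcal{Y}$ and left subspace $\mathcal{Z}$ produces an approximation $s_k$ such that (i) $s_k=x_0+y$ with $y\in\mathcal{Y}$, and (ii) $h^*r(s_k)=0$ for every $h\in\mathcal{Z}$. If $\mathcal{Y}$ is the Krylov subspace $\mathcal{K}_k(C;r_0)=\mathrm{span}\{r_0,Cr_0,\ldots,C^{k-1}r_0\}$, where $r_0=d-Cx_0$, the projection method is called a Krylov subspace method. *)

(* Defs.v *)
From HB Require Import structures.
From mathcomp Require Export all_boot all_order all_algebra.
From mathcomp Require Export sesquilinear spectral.
From mathcomp Require Export reals complex.
Set Implicit Arguments.
Unset Strict Implicit.
Unset Printing Implicit Defensive.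
Import Order.TTheory GRing.Theory Num.Theory.
Local Open Scope ring_scope.
Local Open Scope complex_scope.
Local Open Scope sesquilinear_scope.

(* The order on [R[i]] is partial: [0 < z] says that z is real and positive. *)
Definition hermitian_posdef (R : realType) (n : nat) (A : 'M[R[i]]_n) : Prop :=
  A \is hermsymmx /\
  forall v : 'cV[R[i]]_n, v != 0 -> 0 < (v ^t* *m A *m v) 0 0.

Definition hpd_sqrt (R : realType) (n : nat) (Ah A : 'M[R[i]]_n) : Prop :=
  hermitian_posdef Ah /\ Ah *m Ah = A.

(* Thin singular value decomposition: G has the shape of A, H is square, and
   both have orthonormal columns. *)
Definition thin_svd (R : realType) (m n : nat) (A G : 'M[R[i]]_(m, n))
    (sigma : 'I_n -> R) (H : 'M[R[i]]_n) : Prop :=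
  [/\ G ^t* *m G = 1%:M,
      H ^t* *m H = 1%:M,
      forall i j : 'I_n, (i <= j)%N -> sigma j <= sigma i,
      forall i : 'I_n, 0 <= sigma i
    & A = G *m diag_mx (\row_i (sigma i)%:C) *m H ^t*].

Definition fdiff (R : realType) (N : nat) (x : nat -> 'cV[R[i]]_N) (m : nat) :
    'cV[R[i]]_N := x m.+1 - x m.

Definition diff_mx (R : realType) (N : nat) (x : nat -> 'cV[R[i]]_N)
    (k : nat) : 'M[R[i]]_(N, k.+1) :=
  \matrix_(i < N, j < k.+1) fdiff x j i 0.

Definition scaled_diff_mx (R : realType) (N k : nat) (Mh : 'M[R[i]]_N)
    (Lh : 'M[R[i]]_k.+1) (x : nat -> 'cV[R[i]]_N) : 'M[R[i]]_(N, k.+1) :=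
  Mh *m diff_mx x k *m invmx Lh.

(* The column of H with index [ord_max] is a right singular vector for the
   smallest singular value. *)
Definition svd_mpe_coef (R : realType) (k : nat) (Lh H : 'M[R[i]]_k.+1) :
    'cV[R[i]]_k.+1 := invmx Lh *m col ord_max H.

(* Since [0^-1 = 0], this is the SVD-MPE approximation only when the
   coefficients [c] have a nonzero sum. *)
Definition svd_mpe_approx (R : realType) (N k : nat) (x : nat -> 'cV[R[i]]_N)
    (c : 'cV[R[i]]_k.+1) : 'cV[R[i]]_N :=
  \sum_(i < k.+1) (c i 0 / \sum_(j < k.+1) c j 0) *: x i.

Definition residual (R : realType) (N : nat) (C : 'M[R[i]]_N)
    (d y : 'cV[R[i]]_N) : 'cV[R[i]]_N := d - C *m y.

Definition krylov (R : realType) (N k : nat) (C : 'M[R[i]]_N)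
    (r : 'cV[R[i]]_N) : {vspace 'cV[R[i]]_N} :=
  <<[seq C ^+ i *m r | i <- iota 0 k]>>%VS.

Definition is_projection_method (R : realType) (N k : nat) (C : 'M[R[i]]_N)
    (d x0 : 'cV[R[i]]_N) (Y Z : {vspace 'cV[R[i]]_N})
    (sk : 'cV[R[i]]_N) : Prop :=
  [/\ \dim Y = k,
      \dim Z = k,
      exists2 y : 'cV[R[i]]_N, y \in Y & sk = x0 + y
    & forall h : 'cV[R[i]]_N, h \in Z -> h ^t* *m residual C d sk = 0].

Definition is_krylov_method (R : realType) (N k : nat) (C : 'M[R[i]]_N)
    (d x0 : 'cV[R[i]]_N) (Z : {vspace 'cV[R[i]]_N})
    (sk : 'cV[R[i]]_N) : Prop :=
  is_projection_method k C d x0 (krylov k C (residual C d x0)) Z sk.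

(* [M^{1/2} g_i] for i < k: the last left singular vector [g_k] is left out. *)
Definition left_vec (R : realType) (N k : nat) (Mh : 'M[R[i]]_N)
    (G : 'M[R[i]]_(N, k.+1)) (i : 'I_k) : 'cV[R[i]]_N :=
  Mh *m col (widen_ord (leqnSn k) i) G.

Definition left_space (R : realType) (N k : nat) (Mh : 'M[R[i]]_N)
    (G : 'M[R[i]]_(N, k.+1)) : {vspace 'cV[R[i]]_N} :=
  <<[seq left_vec Mh G i | i <- enum 'I_k]>>%VS.

(* Main.v *)
(* Since u_m = r(x_m), writing S for the sum of the c_j gives
   r(s_k) = S^-1 U_k c, hence
   (M^{1/2} g_i)^* r(s_k) = S^-1 g_i^* (M^{1/2} U_k L^{-1/2}) h_k
                          = S^-1 sigma_k g_i^* g_k = 0  for i < k.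
   The Krylov form follows by induction from
   x_{m+1} - x_0 = (x_m - x_0) + r_0 - C (x_m - x_0), and the same recursion
   places u_0, ..., u_{k-1} in K_k(C; r_0), so that their independence gives it
   dimension k.  The left space has dimension k because M^{1/2} is injective. *)
Require Import Defs.
Set Implicit Arguments.
Unset Strict Implicit.
Unset Printing Implicit Defensive.
Import Order.TTheory GRing.Theory Num.Theory.
Local Open Scope ring_scope.
Local Open Scope complex_scope.
Local Open Scope sesquilinear_scope.

Lemma trmxC_mul (R : realType) (m n p : nat) (A : 'M[R[i]]_(m, n))
    (B : 'M[R[i]]_(n, p)) : (A *m B) ^t* = B ^t* *m A ^t*.
Proof. by rewrite trmx_mul map_mxM. Qed.

Lemma mulmx_col (R : realType) (m n p : nat) (A : 'M[R[i]]_(m, n))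
    (B : 'M[R[i]]_(n, p)) (j : 'I_p) : A *m col j B = col j (A *m B).
Proof. by rewrite !colE mulmxA. Qed.

Lemma hermitian_posdef_trmxC (R : realType) (n : nat) (A : 'M[R[i]]_n) :
  hermitian_posdef A -> A ^t* = A.
(* [hermsymmx] unfolds to an identity with a sign $(-1)^b$; here $b = 0$. *)
Proof. by case=> /is_hermitianmxP hA _; rewrite [RHS]hA expr0 scale1r. Qed.

(** If $Av = 0$ then $v^*Av = 0$, which positivity forbids for $v \neq 0$. This gives the
    injectivity of $M^{1/2}$. *)
Lemma hermitian_posdef_mul_eq0 (R : realType) (n : nat) (A : 'M[R[i]]_n)
    (v : 'cV[R[i]]_n) : hermitian_posdef A -> A *m v = 0 -> v = 0.
Proof.
case=> _ posA Av0; apply/eqP; apply: contraT => /posA.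
by rewrite -mulmxA Av0 mulmx0 mxE ltxx.
Qed.

Section Krylov.
Variables (R : realType) (N : nat) (C : 'M[R[i]]_N).
Implicit Types (r y : 'cV[R[i]]_N) (k m : nat).

Lemma krylovP k r y :
  (exists a : 'I_k -> R[i], y = \sum_(i < k) a i *: (C ^+ i *m r)) <->
  y \in krylov k C r.
Proof.
split=> [[a ->]|].
  apply: memv_suml => i _; apply/memvZ/memv_span/map_f.
  by rewrite mem_iota /= add0n.
have sz : size [seq C ^+ i *m r | i <- iota 0 k] == k.
  by rewrite size_map size_iota.
(* The coefficients are the coordinates of $y$ in the generating tuple; [eexists] leaves them to
   unification. *)
rewrite /krylov -[X in <<X>>%VS]/(tval (Tuple sz)) => /coord_span ->.
eexists; apply: eq_bigr => i _; congr (_ *: _).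
by rewrite (nth_map 0%N) ?size_iota // nth_iota.
Qed.

Lemma krylov_leq k m r : (k <= m)%N -> {subset krylov k C r <= krylov m C r}.
Proof.
move=> le_km; apply/subvP/sub_span/sub_map => i.
by rewrite !mem_iota /= !add0n => /leq_trans; apply.
Qed.

Lemma krylov_gen k r : r \in krylov k.+1 C r.
Proof. by apply: memv_span; rewrite /= expr0 mul1mx mem_head. Qed.

Lemma krylov_mul k r y : y \in krylov k C r -> C *m y \in krylov k.+1 C r.
Proof.
case/krylovP=> a ->; rewrite mulmx_sumr; apply: memv_suml => i _.
rewrite -scalemxAr mulmxA; apply/memvZ/memv_span/mapP; exists i.+1.
  by rewrite mem_iota /= add0n ltnS.
by rewrite exprS.
Qed.

End Krylov.

Section FixedPoint.
Variables (R : realType) (N : nat) (C : 'M[R[i]]_N) (d : 'cV[R[i]]_N).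
Variables (x : nat -> 'cV[R[i]]_N).
Hypothesis hx : forall m : nat, x m.+1 = (1%:M - C) *m x m + d.

Lemma fdiff_residual m : fdiff x m = residual C d (x m).
Proof.
rewrite /fdiff /residual hx mulmxBl mul1mx.
by rewrite addrAC [_ - x m]addrAC subrr add0r addrC.
Qed.

Lemma iterate_krylov m : x m - x 0%N \in krylov m C (residual C d (x 0%N)).
Proof.
elim: m => [|m IHm]; first by rewrite subrr mem0v.
have -> : x m.+1 - x 0%N =
    (x m - x 0%N) + (residual C d (x 0%N) - C *m (x m - x 0%N)).
  have -> : x m.+1 = x m + fdiff x m by rewrite /fdiff addrC subrK.
  rewrite fdiff_residual /residual mulmxBr addrAC; congr (_ + _).
  by rewrite opprB addrA subrK.
(* Only the product with $C$ raises the degree. The vector $r_0$ lies in $\mathcal{K}_{m+1}$ even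
   for $m = 0$, where $\mathcal{K}_m$ is zero. *)
by apply: memvD; [apply: krylov_leq IHm |
  apply: memvB; [apply: krylov_gen | apply: krylov_mul]].
Qed.

Lemma fdiff_krylov m : fdiff x m \in krylov m.+1 C (residual C d (x 0%N)).
Proof.
have -> : fdiff x m = (x m.+1 - x 0%N) - (x m - x 0%N).
  by rewrite /fdiff opprB addrA subrK.
by apply: memvB (iterate_krylov _) _; apply: krylov_leq (iterate_krylov m).
Qed.

(** The $k$ generators bound the dimension from above; the free vectors $u_0, \ldots, u_{k-1}$, all
    in $\mathcal{K}_k$, bound it from below. *)
Lemma dim_krylov k : free [seq fdiff x m | m <- iota 0 k] ->
  \dim (krylov k C (residual C d (x 0%N))) = k.
Proof.
move=> /eqP; rewrite size_map size_iota => dimU.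
apply/eqP; rewrite eqn_leq; apply/andP; split.
  by apply: leq_trans (dim_span _) _; rewrite size_map size_iota.
rewrite -{1}dimU; apply/dimvS/span_subvP => _ /mapP[m + ->].
rewrite mem_iota /= add0n => lt_mk.
exact: krylov_leq lt_mk _ (fdiff_krylov m).
Qed.

(** The weights $\gamma_i$ sum to 1, so $x_0$ can be subtracted inside the sum, and each $x_i - x_0$
    with $i \le k$ lies in $\mathcal{K}_k$. *)
Lemma approx_krylov k (c : 'cV[R[i]]_k.+1) : \sum_j c j 0 != 0 ->
  svd_mpe_approx x c - x 0%N \in krylov k C (residual C d (x 0%N)).
Proof.
move=> c_neq0; have -> : svd_mpe_approx x c - x 0%N =
    \sum_(i < k.+1) (c i 0 / \sum_j c j 0) *: (x i - x 0%N).
  under eq_bigr do rewrite scalerBr.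
  by rewrite big_split /= sumrN -scaler_suml -mulr_suml divff ?scale1r.
apply: memv_suml => i _; apply: memvZ.
by apply: krylov_leq (iterate_krylov i); rewrite -ltnS.
Qed.

Lemma diff_mx_mul k (c : 'cV[R[i]]_k.+1) :
  diff_mx x k *m c = \sum_(i < k.+1) c i 0 *: fdiff x i.
Proof.
apply/colP => j; rewrite mxE summxE; apply: eq_bigr => i _.
by rewrite !mxE mulrC.
Qed.

(** The residual is an affine map, so it commutes with combinations whose weights sum to 1; the
    columns of $U_k$ are the residuals of the iterates. *)
Lemma residual_approx k (c : 'cV[R[i]]_k.+1) : \sum_j c j 0 != 0 ->
  residual C d (svd_mpe_approx x c) = (\sum_j c j 0)^-1 *: (diff_mx x k *m c).
Proof.
move=> c_neq0; rewrite diff_mx_mul scaler_sumr.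
under [RHS]eq_bigr => i _ do
  rewrite scalerA mulrC fdiff_residual /residual scalerBr scalemxAr.
rewrite big_split /= -scaler_suml -mulr_suml divff // scale1r.
by rewrite sumrN -mulmx_sumr.
Qed.

End FixedPoint.

Section LeftSpace.
Variables (R : realType) (N k : nat) (Mh : 'M[R[i]]_N) (G : 'M[R[i]]_(N, k.+1)).
Hypotheses (hMh : hermitian_posdef Mh) (hG : G ^t* *m G = 1%:M).

Lemma trmxC_col (i : 'I_k.+1) : (col i G) ^t* = row i (G ^t*).
Proof. by apply/rowP => j; rewrite !mxE. Qed.

Lemma left_vec_orthogonal (Lh H : 'M[R[i]]_k.+1) (x : nat -> 'cV[R[i]]_N)
    (sigma : 'I_k.+1 -> R) (i : 'I_k) :
  thin_svd (scaled_diff_mx Mh Lh x) G sigma H ->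
  (left_vec Mh G i) ^t* *m (diff_mx x k *m svd_mpe_coef Lh H) = 0.
Proof.
case=> _ hH _ _ svdA.
rewrite /left_vec trmxC_mul (hermitian_posdef_trmxC hMh) trmxC_col.
have -> : forall y : 'rV_N, y *m Mh *m (diff_mx x k *m svd_mpe_coef Lh H) =
    y *m (scaled_diff_mx Mh Lh x *m col ord_max H).
  by move=> y; rewrite /scaled_diff_mx /svd_mpe_coef !mulmxA.
rewrite svdA !mulmx_col -row_mul -mulmxA hH mulmx1 mulmxA hG mul1mx.
(* What remains is the entry of $\Sigma$ in row $i$ and column $k$, off the diagonal since $i <
   k$. *)
apply/matrixP => a b; rewrite !mxE; case: eqP => // /(congr1 val) /= i_k.
by have := ltn_ord i; rewrite i_k ltnn.
Qed.

Lemma left_space_free : free [seq left_vec Mh G i | i <- enum 'I_k].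
Proof.
have sz : size [seq left_vec Mh G i | i <- enum 'I_k] == k.
  by rewrite size_map size_enum_ord.
apply: (introT (freeP (X := Tuple sz))) => a /= sum0 i.
have {sum0} : Mh *m \sum_j a j *: col (widen_ord (leqnSn k) j) G = 0.
  rewrite mulmx_sumr -[RHS]sum0; apply: eq_bigr => j _.
  by rewrite -scalemxAr (nth_map j) ?size_enum_ord ?nth_ord_enum.
move/(hermitian_posdef_mul_eq0 hMh).
(* By orthonormality, multiplying by $g_i^*$ isolates the coefficient $a_i$. *)
move/(congr1 (mulmx (row (widen_ord (leqnSn k) i) (G ^t*)))).
rewrite mulmx0 mulmx_sumr (bigD1 i) //= big1 ?addr0 => [|j /negPf ne_ji].
  rewrite -scalemxAr mulmx_col -row_mul hG => /matrixP/(_ 0 0).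
  by rewrite !mxE eqxx mulr1.
rewrite -scalemxAr mulmx_col -row_mul hG; apply/matrixP => p q.
by rewrite !mxE -val_eqE /= val_eqE eq_sym ne_ji mulr0.
Qed.

Lemma left_space_orthogonal (r : 'cV[R[i]]_N) :
  (forall i : 'I_k, (left_vec Mh G i) ^t* *m r = 0) ->
  forall h, h \in left_space Mh G -> h ^t* *m r = 0.
Proof.
move=> orth h.
rewrite /left_space -[X in <<X>>%VS]/(tval (in_tuple _)) => /coord_span ->.
rewrite raddf_sum /= raddf_sum /= mulmx_suml big1 // => j _.
(* The conjugate transpose is conjugate linear: the coordinates come out conjugated, in front of
   products that vanish. *)
rewrite linearZ /= map_mxZ -scalemxAl.
have /mapP[i _ ->] := mem_nth 0 (ltn_ord j).
by rewrite orth scaler0.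
Qed.

End LeftSpace.

Theorem theorem1 (R : realType) (N k : nat) (hk : (1 <= k)%N)
    (hkN : (k + 1 <= N)%N)
    (C T : 'M[R[i]]_N) (d s : 'cV[R[i]]_N)
    (hs : unique (fun y : 'cV[R[i]]_N => C *m y = d) s)
    (hT : T = 1%:M - C)
    (x : nat -> 'cV[R[i]]_N)
    (hx : forall m : nat, x m.+1 = T *m x m + d)
    (M Mh : 'M[R[i]]_N) (hM : hermitian_posdef M) (hMh : hpd_sqrt Mh M)
    (L Lh : 'M[R[i]]_k.+1) (hL : hermitian_posdef L) (hLh : hpd_sqrt Lh L)
    (G : 'M[R[i]]_(N, k.+1)) (sigma : 'I_k.+1 -> R) (H : 'M[R[i]]_k.+1)
    (hsvd : thin_svd (scaled_diff_mx Mh Lh x) G sigma H)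
    (hex : \sum_(j < k.+1) svd_mpe_coef Lh H j 0 != 0) :
  let sk := svd_mpe_approx x (svd_mpe_coef Lh H) in
  let r0 := residual C d (x 0%N) in
  [/\ exists delta : 'I_k -> R[i],
        sk = x 0%N + \sum_(i < k) delta i *: (C ^+ i *m r0),
      forall h : 'cV[R[i]]_N, h \in left_space Mh G ->
        h ^t* *m residual C d sk = 0,
      forall i : 'I_k, (left_vec Mh G i) ^t* *m residual C d sk = 0
    & free [seq fdiff x m | m <- iota 0 k] ->
        is_krylov_method k C d (x 0%N) (left_space Mh G) sk].
Proof.
move=> sk r0; subst T; have [hMhp _] := hMh; have [hG _ _ _ _] := hsvd.
(* This membership yields both the explicit coefficients $\delta_i$ and the right-subspace
   condition. *)
have sk_krylov : sk - x 0%N \in krylov k C r0 by exact: approx_krylov.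
have orth i : (left_vec Mh G i) ^t* *m residual C d sk = 0.
  rewrite residual_approx // -scalemxAr.
  by rewrite (left_vec_orthogonal hMhp hG _ hsvd) scaler0.
split=> //.
- have /krylovP[delta def_sk] := sk_krylov.
  by exists delta; rewrite -def_sk addrC subrK.
- exact: left_space_orthogonal.
- move=> freeU; split.
  + exact: dim_krylov.
  + have /eqP := left_space_free hMhp hG.
    by rewrite size_map size_enum_ord.
  + by exists (sk - x 0%N); rewrite // addrC subrK.
  + exact: left_space_orthogonal.
Qed.
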